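(* 1. The action of $GL(2,\mathbb H_{\mathbb C})$ given, for $h\in GL(2,\mathbb H_{\mathbb C})$ with $h^{-1}=\begin{pmatrix} a&b\\c&d\end{pmatrix}$, by $$(\pi_{dl}(h)f)(Z)=\frac{(cZ+d)^{-1}\otimes(cZ+d)^{-1}}{N(cZ+d)}\cdot f\bigl((aZ+b)(cZ+d)^{-1}\bigr)$$ preserves doubly left regular functions: if $U\subset\mathbb H_{\mathbb C}$ is open and $f:U\to\mathbb S\odot\mathbb S$ is a holomorphic doubly left regular function, then $\pi_{dl}(h)f$ is a holomorphic doubly left regular function with values in $\mathbb S\odot\mathbb S$ (on the open set of those $Z$ with $N(cZ+d)\neq0$ and $(aZ+b)(cZ+d)^{-1}\in U$). 2. The action of $GL(2,\mathbb H_{\mathbb C})$ given, for $h=\begin{pmatrix} a'&b'\\c'&d'\end{pmatrix}\in GL(2,\mathbb H_{\mathbb C})$, by $$(\pi_{dr}(h)g)(Z)=g\bigl((a'-Zc')^{-1}(-b'+Zd')\bigr)\cdot\frac{(a'-Zc')^{-1}\otimes(a'-Zc')^{-1}}{N(a'-Zc')}$$ preserves doubly right regular functions: if $g:U\to\mathbb S'\odot\mathbb S'$ is a holomorphic doubly right regular function on an open set $U\subset\mathbb H_{\mathbb C}$, then $\pi_{dr}(h)g$ is a holomorphic doubly right regular function with values in $\mathbb S'\odot\mathbb S'$ (on the open set of those $Z$ with $N(a'-Zc')\ne0$ and $(a'-Zc')^{-1}(-b'+Zd')\in U$).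
   Context: $\mathbb H_{\mathbb C}=\mathbb C\otimes_{\mathbb R}\mathbb H$ is identified with complex $2\times2$ matrices via $e_0=I$, $e_1=\begin{pmatrix}0&-i\\-i&0\end{pmatrix}$, $e_2=\begin{pmatrix}0&-1\\1&0\end{pmatrix}$, $e_3=\begin{pmatrix}-i&0\\0&i\end{pmatrix}$; $Z=\sum_j z^je_j$ with $z^j\in\mathbb C$, and $N(Z)=\det Z=\sum_j(z^j)^2$. $GL(2,\mathbb H_{\mathbb C})\cong GL(4,\mathbb C)$ is the group of invertible $2\times 2$ block matrices with entries in $\mathbb H_{\mathbb C}$; $a,b,c,d,a',b',c',d'\in\mathbb H_{\mathbb C}$. $\mathbb S$ (resp. $\mathbb S'$) is the space of complex columns (resp. rows) of length 2 with left (resp. right) multiplication by $\mathbb H_{\mathbb C}$. $\mathbb S\otimes\mathbb S$ is a left and $\mathbb S'\otimes\mathbb S'$ a right $\mathbb H_{\mathbb C}\otimes\mathbb H_{\mathbb C}$-module; $\odot$ denotes the symmetric part of the tensor square. Put $\nabla^+\otimes1=\sum_{j=0}^3(e_j\otimes1)\frac{\partial}{\partial z^j}$ and $1\otimes\nabla^+=\sum_{j=0}^3(1\otimes e_j)\frac{\partial}{\partial z^j}$. A holomorphic $f:U\to\mathbb S\odot\mathbb S$ is doubly left regular if $(\nabla^+\otimes1)f=0$ and $(1\otimes\nabla^+)f=0$ on $U$ (operators applied on the left). A holomorphic $g:U\to\mathbb S'\odot\mathbb S'$ is doubly right regular if $\sum_j\frac{\partial g}{\partial z^j}(e_j\otimes1)=0$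 and $\sum_j\frac{\partial g}{\partial z^j}(1\otimes e_j)=0$ on $U$. *)

(* Defs.v *)
From HB Require Import structures.
From mathcomp Require Import all_boot all_order all_algebra.
From mathcomp Require Import complex mxtens ring.
From mathcomp Require Import all_classical all_reals all_analysis.

Set Implicit Arguments.
Unset Strict Implicit.
Unset Printing Implicit Defensive.

Import Order.TTheory GRing.Theory Num.Theory.
Import numFieldNormedType.Exports.

Local Open Scope classical_set_scope.
Local Open Scope complex_scope.
Local Open Scope ring_scope.

(* The complex numbers over R, with the topology given by the modulus. Sealing
   R[i] behind a numClosedFieldType is what lets the generic normed-module
   instances on a numFieldType apply. *)
Definition CC (R : realType) : numClosedFieldType := R[i].

(* The complexified quaternions, as complex 2x2 matrices. *)
Notation HC R := 'M[CC R]_2.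

(* The tensor squares of the spaces of columns and of rows of length 2: the
   entry of index mxtens_index (i, j) is the coefficient on the tensor product
   of the i-th and j-th basis vectors. The simple tensor of x and y is x *t y
   (Kronecker product), and the tensor product of p and q in HC R acts on these
   spaces by multiplication by p *t q : 'M_(2 * 2). *)
Notation SS R := 'cV[CC R]_(2 * 2).
Notation SS' R := 'rV[CC R]_(2 * 2).

Section DoublyRegular.
Variable R : realType.
Implicit Types (h : 'M[CC R]_(2 + 2)) (U : set (HC R)).

Definition mx2 (a b c d : CC R) : HC R :=
  \matrix_(i, j) nth 0 (nth [::] [:: [:: a; b]; [:: c; d]] i) j.

Definition e (j : 'I_4) : HC R :=
  tnth [tuple mx2 1 0 0 1;
              mx2 0 (- 'i) (- 'i) 0;
              mx2 0 (-1) 1 0;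
              mx2 (- 'i) 0 0 'i] j.

Definition N (Z : HC R) : CC R := \det Z.

Lemma N_coord (z : 'I_4 -> CC R) : N (\sum_j z j *: e j) = \sum_j z j ^+ 2.
Proof.
rewrite /N (expand_det_row _ 0) !big_ord_recl !big_ord0 /cofactor !det_mx11.
rewrite !(mxE, tnth_nth 0) /=.
rewrite /bump /= expr0 expr1; have := mulCii (CC R); move: 'i => i Ei.
ring: Ei.
Qed.

(* Membership in the symmetric part of the tensor squares: invariance under the
   exchange of the two tensor factors. *)
Definition symS (u : SS R) : Prop :=
  forall i j : 'I_2, u (mxtens_index (i, j)) 0 = u (mxtens_index (j, i)) 0.

Definition symS' (v : SS' R) : Prop :=
  forall i j : 'I_2, v 0 (mxtens_index (i, j)) = v 0 (mxtens_index (j, i)).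

(* In the coordinates Z = \sum_j z j *: e j, the partial derivative with respect
   to z j is the complex directional derivative 'D_(e j). For functions of
   several variables over CC R, differentiable is complex (Frechet)
   differentiability. Functions on U are total functions whose values outside
   the open set U are irrelevant. *)
Definition doubly_left_regular U (f : HC R -> SS R) : Prop :=
  [/\ forall Z, U Z -> symS (f Z),
      forall Z, U Z -> differentiable f Z,
      forall Z, U Z -> \sum_j (e j *t 1%:M) *m 'D_(e j) f Z = 0
    & forall Z, U Z -> \sum_j (1%:M *t e j) *m 'D_(e j) f Z = 0].

Definition doubly_right_regular U (g : HC R -> SS' R) : Prop :=
  [/\ forall Z, U Z -> symS' (g Z),
      forall Z, U Z -> differentiable g Z,
      forall Z, U Z -> \sum_j 'D_(e j) g Z *m (e j *t 1%:M) = 0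
    & forall Z, U Z -> \sum_j 'D_(e j) g Z *m (1%:M *t e j) = 0].

(* GL(2, HC) is the group of invertible 'M_(2 + 2), an element h being the block
   matrix with blocks ulsubmx h, ursubmx h, dlsubmx h and drsubmx h. The left
   action is written in terms of the blocks of the inverse of h, the right
   action in terms of those of h itself. *)
Definition den_l h (Z : HC R) : HC R :=
  let c := dlsubmx (invmx h) in let d := drsubmx (invmx h) in
  c *m Z + d.

Definition mob_l h (Z : HC R) : HC R :=
  let a := ulsubmx (invmx h) in let b := ursubmx (invmx h) in
  (a *m Z + b) *m invmx (den_l h Z).

Definition pi_dl h (f : HC R -> SS R) (Z : HC R) : SS R :=
  ((N (den_l h Z))^-1 *: (invmx (den_l h Z) *t invmx (den_l h Z)))
    *m f (mob_l h Z).

Definition dom_dl h U : set (HC R) :=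
  [set Z | N (den_l h Z) != 0 /\ U (mob_l h Z)].

Definition den_r h (Z : HC R) : HC R :=
  let a' := ulsubmx h in let c' := dlsubmx h in
  a' - Z *m c'.

Definition mob_r h (Z : HC R) : HC R :=
  let b' := ursubmx h in let d' := drsubmx h in
  invmx (den_r h Z) *m (- b' + Z *m d').

Definition pi_dr h (g : HC R -> SS' R) (Z : HC R) : SS' R :=
  g (mob_r h Z)
    *m ((N (den_r h Z))^-1 *: (invmx (den_r h Z) *t invmx (den_r h Z))).

Definition dom_dr h U : set (HC R) :=
  [set Z | N (den_r h Z) != 0 /\ U (mob_r h Z)].

End DoublyRegular.

(* Main.v *)
Require Import Defs.
From HB Require Import structures.
From mathcomp Require Import all_boot all_order all_algebra.
From mathcomp Require Import complex mxtens ring.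
From mathcomp Require Import all_classical all_reals all_analysis.

Set Implicit Arguments.
Unset Strict Implicit.
Unset Printing Implicit Defensive.

Import Order.TTheory GRing.Theory Num.Theory.
Import numFieldNormedType.Exports.
Local Open Scope classical_set_scope.
Local Open Scope ring_scope.

(* Identify an element of S (x) S with a 2x2 matrix G, on which p (x) q acts by
   p G q^T; symmetric tensors are symmetric matrices, and exchanging the factors
   transposes G. With q = cZ + d, p = q^-1, w = (aZ + b) p and m = p c, the
   function F = slash G : Z |-> det p . p G(w) p^T has, writing Y for F(Z),
     dF(X) = det p . p dG_w((a - wc) X p) p^T
             - (tr(mX) Y + mX Y + Y (mX)^T).
   The equation \sum_j e_j L(e_j) = 0 on a linear map L amounts to equalities
   between entries of L at matrix units (delta_regular). It is inherited by
   X |-> det p . p L(a' X p) p^T, and holds for the map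
   X |-> tr(mX) Y + mX Y + Y (mX)^T as soon as Y is symmetric: the contributions
   of the first two terms cancel and that of the last one vanishes by symmetry.
   The right action is the left one conjugated by transposition. *)

(** * Two-by-two matrices in coordinates *)

Lemma I2_case (k : 'I_2) : k = 0 \/ k = 1.
Proof. by case: k => [[|[|//]]] ?; [left|right]; exact/val_inj. Qed.

Lemma sum2E (V : nmodType) (F : 'I_2 -> V) : \sum_i F i = F 0 + F 1.
Proof.
rewrite !big_ord_recl big_ord0 addr0.
by congr (F _ + F _); exact/val_inj.
Qed.

Lemma det_mx2 (A : comNzRingType) (M : 'M[A]_2) :
  \det M = M 0 0 * M 1 1 - M 0 1 * M 1 0.
Proof.
have l0 : lift 0 0 = 1 :> 'I_2 by exact/val_inj.
have l1 : lift 1 0 = 0 :> 'I_2 by exact/val_inj.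
rewrite (expand_det_row _ 0) sum2E /cofactor !det_mx11 !mxE l0 l1.
by rewrite expr0 expr1 mul1r mulN1r mulrN.
Qed.

Lemma mxtrace2 (A : comNzRingType) (M : 'M[A]_2) : \tr M = M 0 0 + M 1 1.
Proof. exact: sum2E. Qed.

Lemma mulmx2E (A : comNzRingType) m n (M : 'M[A]_(m, 2)) (N : 'M[A]_(2, n)) i j :
  (M *m N) i j = M i 0 * N 0 j + M i 1 * N 1 j.
Proof. by rewrite mxE sum2E. Qed.

Lemma matrix2P (A : Type) (M N : 'M[A]_2) :
  M 0 0 = N 0 0 -> M 0 1 = N 0 1 -> M 1 0 = N 1 0 -> M 1 1 = N 1 1 -> M = N.
Proof.
move=> M00 M01 M10 M11; apply/matrixP => i j.
by case: (I2_case i) => ->; case: (I2_case j) => ->.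
Qed.

(** In this form the adjugate is linear in [M], which makes the inverse a visibly differentiable
    expression. *)
Lemma adj_mx2 (A : comNzRingType) (M : 'M[A]_2) : \adj M = (\tr M)%:M - M.
Proof.
have l0 : lift 0 0 = 1 :> 'I_2 by exact/val_inj.
have l1 : lift 1 0 = 0 :> 'I_2 by exact/val_inj.
by apply: matrix2P; rewrite !mxE /cofactor !det_mx11 !mxE mxtrace2 ?l0 ?l1 /=
  ?expr0 ?expr1 ?mulr1n ?mulr0n; ring.
Qed.

(** * The regularity equation as a condition on linear maps *)

Section Algebra.
Variable K : numFieldType.
Implicit Types L M : {linear 'M[K]_2 -> 'M[K]_2}.

Lemma matrix2E (M : 'M[K]_2) :
  M = M 0 0 *: delta_mx 0 0 + M 0 1 *: delta_mx 0 1 +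
      (M 1 0 *: delta_mx 1 0 + M 1 1 *: delta_mx 1 1).
Proof. by rewrite {1}[M]matrix_sum_delta !sum2E. Qed.

Lemma linear_mx2E L X :
  L X = X 0 0 *: L (delta_mx 0 0) + X 0 1 *: L (delta_mx 0 1) +
        (X 1 0 *: L (delta_mx 1 0) + X 1 1 *: L (delta_mx 1 1)).
Proof. by rewrite {1}[X]matrix2E !linearD !linearZ. Qed.

(** For [L] the differential of [G], column [l] of [G] is curl-free in the variables of row [k] of
    [Z]. Equivalently, the entry [(r, l)] of [L (delta_mx k c)] is symmetric in [r] and [c]. *)
Definition delta_regular (L : 'M[K]_2 -> 'M[K]_2) := forall k l,
  L (delta_mx k 1) 0 l = L (delta_mx k 0) 1 l.

(** After expansion in matrix units half of the terms cancel and the others occur twice; 2 is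
    invertible in [K]. *)
Lemma quaternion_sum_eq0P (i : K) (E0 E1 E2 E3 : 'M[K]_2) L : i * i = -1 ->
  E0 = delta_mx 0 0 + delta_mx 1 1 ->
  E1 = - i *: (delta_mx 0 1 + delta_mx 1 0) ->
  E2 = delta_mx 1 0 - delta_mx 0 1 ->
  E3 = i *: (delta_mx 1 1 - delta_mx 0 0) ->
  E0 *m L E0 + E1 *m L E1 + (E2 *m L E2 + E3 *m L E3) = 0 <->
  delta_regular L.
Proof.
move=> Ei E0E E1E E2E E3E.
(* Row 0 of the sum carries the condition for [k = 1] and row 1 the one for [k = 0], up to the
   factor 2 and a sign. *)
pose D : 'M[K]_2 := \matrix_(k, l)
    if k == 0 then 2 * (L (delta_mx 1 1) 0 l - L (delta_mx 1 0) 1 l)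
    else 2 * (L (delta_mx 0 0) 1 l - L (delta_mx 0 1) 0 l).
set S := (X in X = 0); have -> : S = D.
  have L0 : L E0 = L (delta_mx 0 0) + L (delta_mx 1 1) by rewrite E0E linearD.
  have L1 : L E1 = - i *: (L (delta_mx 0 1) + L (delta_mx 1 0)).
    by rewrite E1E linearZ linearD.
  have L2 : L E2 = L (delta_mx 1 0) - L (delta_mx 0 1) by rewrite E2E linearB.
  have L3 : L E3 = i *: (L (delta_mx 1 1) - L (delta_mx 0 0)).
    by rewrite E3E linearZ linearB.
  rewrite /S L0 L1 L2 L3 E0E E1E E2E E3E.
  by apply: matrix2P; rewrite !(mxE, sum2E) /=; ring: Ei.
have two0 : (2 : K) != 0 by rewrite pnatr_eq0.
split=> [D0 k l | Lr].
  have D0l r : D r l = 0 by rewrite D0 mxE.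
  apply/eqP; case: (I2_case k) => ->; [rewrite eq_sym|]; rewrite -subr_eq0.
    by have /eqP := D0l 1; rewrite mxE mulf_eq0 (negPf two0).
  by have /eqP := D0l 0; rewrite mxE mulf_eq0 (negPf two0).
by apply/matrixP => k l; rewrite !mxE !Lr; case: ifP; rewrite subrr mulr0.
Qed.

(** At [delta_mx k c], the entry [(r, l)] is a sum of terms containing
    [p r r' * p c t * L (delta_mx s t) r' u]. Exchanging [r] and [c] amounts to exchanging [r'] and
    [t], under which the entry of [L] is symmetric. *)
Lemma delta_regular_mul L (p a : 'M[K]_2) :
  delta_regular L ->
  delta_regular (fun X => \det p *: (p *m L (a *m X *m p) *m p^T)).
Proof.
move=> Lr k l.
have pLE B r : (p *m B *m p^T) r l = p r 0 * (B 0 0 * p l 0 + B 0 1 * p l 1) +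
    p r 1 * (B 1 0 * p l 0 + B 1 1 * p l 1).
  by rewrite !(mxE, sum2E); ring.
have aE c s t : (a *m delta_mx k c *m p) s t = a s k * p c t.
  rewrite mxE sum2E ![(a *m _) _ _]mxE !sum2E !mxE.
  by case: (I2_case k) => ->; case: (I2_case c) => -> /=; ring.
by rewrite [LHS]mxE [RHS]mxE !pLE !(linear_mx2E L (_ *m _)) !aE !mxE !Lr; ring.
Qed.

(** At [delta_mx k c], the entry [(r, l)] is [m c k * Y r l + m r k * Y c l + Y r c * m l k], which
    is symmetric in [r] and [c] when [Y] is. *)
Lemma delta_regular_mulD (m Y : 'M[K]_2) : Y^T = Y ->
  delta_regular (fun X =>
    \tr (m *m X) *: Y + (m *m X *m Y + Y *m (m *m X)^T)).
Proof.
move=> Ysym k l.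
have Y10 : Y 1 0 = Y 0 1 by rewrite -[in LHS]Ysym mxE.
have mE c s t : (m *m delta_mx k c) s t = m s k * (t == c)%:R.
  by rewrite mxE sum2E !mxE; case: (I2_case k) => -> /=; ring.
rewrite !mxE !mxtrace2 !sum2E ![_^T _ _]mxE !mE.
by case: (I2_case l) => -> /=; rewrite Y10; ring.
Qed.

End Algebra.

(** * Differentials of matrix-valued functions *)

Section Calculus.
Variables (K : numFieldType) (V : normedModType K).

(** The little-o expansion passes from [f] to [g] and determines the differential. This serves for
    [invmx], whose cofactor formula holds only at invertible matrices. *)
Lemma near_eq_is_diff (W : normedModType K) (f g df : V -> W) (x : V) :
  {near x, f =1 g} -> is_diff x f df -> is_diff x g df.
Proof.
move=> fg [dfx dfE].
have fg0 : \forall h \near (0 : V), f (h + x) = g (h + x).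
  have := fg; rewrite (near_shift (0 : V)); apply: filterS => h /=.
  by rewrite subr0.
have gE : g \o shift x = cst (g x) + 'd f x +o_ 0 id.
  have fgx : f x = g x := nbhs_singleton fg.
  have /diff_locallyP[_ /eqaddoP fo] := dfx.
  apply/eqaddoP => eps eps0; near=> h.
  have -> : (g \o shift x - (cst (g x) + 'd f x)) h =
            (f \o shift x - (cst (f x) + 'd f x)) h.
    rewrite !fctE /= fgx; congr (_ - _); apply/esym.
    by near: h.
  by near: h; exact: fo.
have dgE : 'd g x = df :> (V -> W).
  by rewrite -dfE; apply: diff_unique gE; apply: diff_continuous.
split=> //; apply/diff_locallyP; rewrite dgE -dfE.
by split=> //; apply: diff_continuous.
Unshelve. all: by end_near. Qed.

Lemma is_diff_sum (W : normedModType K) n (f df : 'I_n -> V -> W) (x : V) :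
  (forall i, is_diff x (f i) (df i)) ->
  is_diff x (\sum_i f i) (\sum_i df i).
Proof.
move=> fx; elim/big_ind2 : _ => // [|f1 df1 f2 df2 f1x f2x].
  exact: is_diff_cst.
exact: is_diffD.
Qed.

Lemma is_diff_coord m n (F dF : V -> 'M[K]_(m, n)) (x : V) i j :
  is_diff x F dF -> is_diff x (fun z => F z i j) (fun v => dF v i j).
Proof.
move=> Fx.
pose c (M : 'M[K]_(m, n)) := M i j.
have c_lin : linear c by move=> a A B; rewrite /c !mxE.
pose cL : {linear _ -> _} :=
  HB.pack c (GRing.isLinear.Build _ _ _ _ _ c_lin).
have Dc M : is_diff M c c.
  have cc : continuous cL by exact: coord_continuous.
  by split; [exact: (linear_differentiable _ cc) | exact: (diff_lin _ cc)].
exact: (is_diff_comp Fx (Dc (F x))).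
Qed.

(** [F] is the sum of its entries times constant matrix units, hence differentiable; the
    differential is then read off entry by entry. *)
Lemma is_diff_mx m n (F dF : V -> 'M[K]_(m, n)) (x : V) :
  (forall i j, is_diff x (fun z => F z i j) (fun v => dF v i j)) ->
  is_diff x F dF.
Proof.
move=> Fx.
have dF_x : differentiable F x.
  have -> : F = \sum_i \sum_j (fun z => F z i j *: delta_mx i j).
    apply/funext => z; rewrite {1}[F z]matrix_sum_delta fct_sumE.
    by apply: eq_bigr => i _; rewrite fct_sumE.
  apply: differentiable_sum => i; apply: differentiable_sum => j.
  by apply: differentiableZl; case: (Fx i j).
split=> //; apply/funext => v; apply/matrixP => i j.
have [_ dF_ij] := Fx i j; rewrite -[RHS]/((fun v => dF v i j) v) -dF_ij.
by have [_ ->] := is_diff_coord i j (differentiableP dF_x).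
Qed.

Lemma is_diff_mulmx m n p (F dF : V -> 'M[K]_(m, n)) (G dG : V -> 'M[K]_(n, p))
    (x : V) :
  is_diff x F dF -> is_diff x G dG ->
  is_diff x (fun z => F z *m G z) (fun v => dF v *m G x + F x *m dG v).
Proof.
move=> Fx Gx; apply: is_diff_mx => i j.
have FGx k := is_diffM (is_diff_coord i k Fx) (is_diff_coord k j Gx).
have -> : (fun z => (F z *m G z) i j) =
    \sum_k ((fun z => F z i k) * (fun z => G z k j)).
  by apply/funext => z; rewrite mxE fct_sumE.
apply: is_diff_eq (is_diff_sum FGx) _; apply/funext => v.
rewrite !mxE fct_sumE -big_split; apply: eq_bigr => k _ /=.
by rewrite !fctE /= /GRing.scale /= addrC [_ * dF _ _ _]mulrC.
Qed.

(** Jacobi's formula, by the product rule on the two-term determinant. *)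
Lemma is_diff_det2 (q dq : V -> 'M[K]_2) (x : V) :
  is_diff x q dq ->
  is_diff x (fun z => \det (q z)) (fun v => \tr (\adj (q x) *m dq v)).
Proof.
move=> qx.
have -> : (fun z => \det (q z)) =
    (fun z => q z 0 0) * (fun z => q z 1 1) -
    (fun z => q z 0 1) * (fun z => q z 1 0).
  by apply/funext => z; rewrite det_mx2.
have D i j := is_diff_coord i j qx.
apply: is_diff_eq (is_diffB (is_diffM (D _ _) (D _ _))
                            (is_diffM (D _ _) (D _ _))) _.
apply/funext => v; rewrite mxtrace2 !mulmx2E adj_mx2 mxtrace2 !mxE /=.
by rewrite !fctE /GRing.scale /=; ring.
Qed.

Lemma is_diff_scalemx m n (k dk : V -> K) (F dF : V -> 'M[K]_(m, n)) (x : V) :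
  is_diff x k dk -> is_diff x F dF ->
  is_diff x (fun z => k z *: F z) (fun v => dk v *: F x + k x *: dF v).
Proof.
move=> kx Fx; apply: is_diff_mx => i j.
have -> : (fun z => (k z *: F z) i j) = k * (fun z => F z i j).
  by apply/funext => z; rewrite mxE.
apply: is_diff_eq (is_diffM kx (is_diff_coord i j Fx)) _.
by apply/funext => v; rewrite !mxE !fctE /GRing.scale /= addrC [_ * dk v]mulrC.
Qed.

Lemma is_diff_trmx m n (F dF : V -> 'M[K]_(m, n)) (x : V) :
  is_diff x F dF -> is_diff x (fun z => (F z)^T) (fun v => (dF v)^T).
Proof.
move=> Fx; apply: is_diff_mx => i j.
have -> : (fun z => (F z)^T i j) = (fun z => F z j i).
  by apply/funext => z; rewrite mxE.
apply: is_diff_eq (is_diff_coord j i Fx) _.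
by apply/funext => v; rewrite mxE.
Qed.

Lemma near_unitmx2 (q dq : V -> 'M[K]_2) (x : V) :
  is_diff x q dq -> q x \in unitmx -> \near x, q x \in unitmx.
Proof.
move=> qx; rewrite unitmxE unitfE => qx0.
have [/differentiable_continuous cq _] := is_diff_det2 qx.
have cq0 : \forall z \near x, \det (q z) != 0 := cvgr_neq0 _ cq qx0.
by near=> z; rewrite unitmxE unitfE; near: z; exact: cq0.
Unshelve. all: by end_near. Qed.

Lemma is_diff_invmx2 (q dq : V -> 'M[K]_2) (x : V) :
  is_diff x q dq -> q x \in unitmx ->
  is_diff x (fun z => invmx (q z))
            (fun v => - (invmx (q x) *m dq v *m invmx (q x))).
Proof.
move=> qx ux; have nu := near_unitmx2 qx ux.
(* Only differentiability is obtained here, the differential being left as an unevaluated ['d]. The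
   cofactor formula holds near [x] but not at singular matrices, which [invmx] returns unchanged by
   convention. *)
have [dp _] : is_diff x (fun z => invmx (q z))
    ('d (fun z => (\det (q z))^-1 *: ((\tr (q z))%:M - q z)) x).
  apply: (@near_eq_is_diff _
      (fun z => (\det (q z))^-1 *: ((\tr (q z))%:M - q z))).
    near=> z; rewrite -adj_mx2 /invmx ifT //; near: z; exact: nu.
  apply: differentiableP.
  have [dq0 _] := is_diff_det2 qx.
  have qx0 : \det (q x) != 0 by move: ux; rewrite unitmxE unitfE.
  have [dV _] := differentiableP (differentiableV dq0 qx0).
  have D : differentiable (fun z => (\tr (q z))%:M - q z) x.
    have t i j := is_diff_coord i j qx.
    have trx : differentiable (fun z => \tr (q z)) x.
      have -> : (fun z => \tr (q z)) = (fun z => q z 0 0) + (fun z => q z 1 1).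
        by apply/funext => z; rewrite mxtrace2.
      by case: (is_diffD (t 0 0) (t 1 1)).
    apply: differentiableB; last by case: qx.
    have -> : (fun z => (\tr (q z))%:M) =
        (fun z => \tr (q z) *: (1%:M : 'M[K]_2)).
      by apply/funext => z; rewrite scalemx1.
    exact: differentiableZl.
  by case: (is_diff_scalemx (differentiableP dV) (differentiableP D)).
(* Its differential is found by differentiating invmx (q z) *m q z = 1. *)
apply: is_diff_eq (differentiableP dp) _; apply/funext => v.
have [_ e1] := is_diff_mulmx (differentiableP dp) qx.
have [_ e0] : is_diff x (fun z => invmx (q z) *m q z) 0.
  apply: near_eq_is_diff (is_diff_cst 1%:M x).
  by near=> z; rewrite mulVmx //; near: z; exact: nu.
have e (u : V) : invmx (q x) *m dq u =
    - ('d (fun z => invmx (q z)) x u *m q x).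
  apply/eqP; rewrite -addr_eq0 addrC; apply/eqP.
  exact: (congr1 (fun F : V -> 'M[K]_2 => F u) (etrans (esym e1) e0)).
by rewrite e mulNmx opprK mulmxK.
Unshelve. all: by end_near. Qed.

End Calculus.

(** * Fractional linear maps and the weighted action on matrix-valued functions *)

Section Mobius.
Variables (K : numFieldType) (a b c d : 'M[K]_2).
Implicit Types (Z X : 'M[K]_2) (G : 'M[K]_2 -> 'M[K]_2).

(** The blocks are parameters so as to serve both actions: the left one takes those of [invmx h],
    the right one transposes, up to sign, of those of [h]. *)
Definition den Z := c *m Z + d.
Definition mob Z := (a *m Z + b) *m invmx (den Z).

Lemma is_diff_affine (m n : 'M[K]_2) Z :
  is_diff Z (fun X => m *m X + n) (fun X => m *m X).
Proof.
apply: is_diff_eq (is_diffD (is_diff_mulmx (is_diff_cst m Z) (is_diff_id Z))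
                            (is_diff_cst n Z)) _.
by apply/funext => X; rewrite !fctE mul0mx add0r addr0.
Qed.

Lemma is_diff_den_inv Z : den Z \in unitmx ->
  is_diff Z (fun X => invmx (den X))
    (fun X => - (invmx (den Z) *m c *m X *m invmx (den Z))).
Proof.
move=> uZ; apply: is_diff_eq (is_diff_invmx2 (is_diff_affine c d Z) uZ) _.
by apply/funext => X; rewrite !mulmxA.
Qed.

(** With [p] the inverse of [den Z], the product rule gives [a X p - (a Z + b) p c X p], in which
    [(a Z + b) p] is [mob Z] again. *)
Lemma is_diff_mob Z : den Z \in unitmx ->
  is_diff Z mob (fun X => (a - mob Z *m c) *m X *m invmx (den Z)).
Proof.
move=> uZ.
apply: is_diff_eq (is_diff_mulmx (is_diff_affine a b Z) (is_diff_den_inv uZ)) _.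
by apply/funext => X; rewrite mulmxN !mulmxBl !mulmxA.
Qed.

Definition slash G Z := let p := invmx (den Z) in
  \det p *: (p *m G (mob Z) *m p^T).

Lemma is_diff_slash G Z : den Z \in unitmx -> differentiable G (mob Z) ->
  let p := invmx (den Z) in
  let m := p *m c in let Y := \det p *: (p *m G (mob Z) *m p^T) in
  is_diff Z (slash G) (fun X =>
    \det p *: (p *m 'd G (mob Z) ((a - mob Z *m c) *m X *m p) *m p^T) -
    (\tr (m *m X) *: Y + (m *m X *m Y + Y *m (m *m X)^T))).
Proof.
move=> uZ dG p m Y.
have Dp := is_diff_den_inv uZ; rewrite -/p -/m in Dp.
have DG := is_diff_comp (is_diff_mob uZ) (differentiableP dG).
apply: is_diff_eq (is_diff_scalemx (is_diff_det2 Dp)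
  (is_diff_mulmx (is_diff_mulmx Dp DG) (is_diff_trmx Dp))) _.
apply/funext => X /=; rewrite -/p.
(* Cyclicity of the trace brings [p] next to its adjugate, and their product is the scalar matrix of
   [\det p]. *)
have -> : \tr (\adj p *m - (m *m X *m p)) = - (\det p * \tr (m *m X)).
  rewrite mulmxN linearN /= mxtrace_mulC -(mulmxA (m *m X)) mul_mx_adj.
  by rewrite mul_mx_scalar linearZ.
have -> : (- (m *m X *m p))^T = - (p^T *m (m *m X)^T).
  by rewrite linearN /= trmx_mul.
rewrite /Y mulNmx mulmxDl mulNmx mulmxN !scalerDr !scalerN !mulmxA scalerA.
rewrite !scaleNr [_ * \det p]mulrC -!scalemxAl -!scalemxAr !mulmxA.
have addE (A B D E : 'M[K]_2) : - A + (- B + D - E) = D - (A + (B + E)).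
  by rewrite !opprD [D + _]addrCA [D + _]addrCA !addrA.
exact: addE.
Qed.

Lemma delta_regular_slash G Z : den Z \in unitmx -> differentiable G (mob Z) ->
  (G (mob Z))^T = G (mob Z) -> delta_regular ('d G (mob Z)) ->
  delta_regular ('d (slash G) Z).
Proof.
move=> uZ dG Gsym Gr k l.
have [_ ->] := is_diff_slash uZ dG.
set p := invmx (den Z); set Y := \det p *: (p *m G (mob Z) *m p^T).
have Ysym : Y^T = Y by rewrite linearZ /= !trmx_mul trmxK Gsym mulmxA.
have Lr := delta_regular_mul p (a - mob Z *m c) Gr k l.
have Cr := delta_regular_mulD (p *m c) Ysym k l.
have subE (A B : 'M[K]_2) i j : (A - B) i j = A i j - B i j by rewrite !mxE.
by rewrite !subE; congr (_ - _).
Qed.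

Lemma open_mob (U : set 'M[K]_2) : open U ->
  open [set Z | den Z \in unitmx /\ U (mob Z)].
Proof.
move=> oU; rewrite openE => Z [uZ Uw]; rewrite /interior.
have Un : \forall X \near Z, den X \in unitmx.
  exact: near_unitmx2 (is_diff_affine c d Z) uZ.
have [/differentiable_continuous cw _] := is_diff_mob uZ.
have Ww : \forall X \near Z, U (mob X).
  by apply: cw; exact: open_nbhs_nbhs.
by near=> X; split; near: X.
Unshelve. all: by end_near. Qed.

End Mobius.

(** * The quaternionic differential equation at a point *)

Section Regular.
Variable R : realType.
Implicit Types (G : HC R -> HC R) (Z : HC R).

Definition regular_at G Z := \sum_j e R j *m 'D_(e R j) G Z = 0.

Lemma mx2_delta (a b c d : CC R) : mx2 a b c d =
  a *: delta_mx 0 0 + b *: delta_mx 0 1 + (c *: delta_mx 1 0 + d *: delta_mx 1 1).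
Proof. by rewrite [LHS]matrix2E !mxE. Qed.

Lemma regular_atP G Z : differentiable G Z ->
  regular_at G Z <-> delta_regular ('d G Z).
Proof.
move=> dG; rewrite /regular_at.
under eq_bigr do rewrite (deriveE _ dG).
rewrite !big_ord_recl big_ord0 addr0 addrA.
have mx2i (i : CC R) :
    mx2 0 (- i) (- i) 0 = - i *: (delta_mx 0 1 + delta_mx 1 0) /\
    mx2 (- i) 0 0 i = i *: (delta_mx 1 1 - delta_mx 0 0).
  split; rewrite mx2_delta !scale0r ?add0r ?addr0 ?scalerDr //.
  by rewrite scalerN scaleNr addrC.
have [e1E e3E] := mx2i 'i.
apply: (quaternion_sum_eq0P ('d G Z) (mulCii (CC R)));
  rewrite /e !(tnth_nth 0) /= ?e1E ?e3E //.
- by rewrite mx2_delta !scale0r !scale1r addr0 add0r.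
- by rewrite mx2_delta !scale0r scaleN1r scale1r add0r addr0 addrC.
Qed.

End Regular.

(** * Tensors as two-by-two matrices *)

Section Vec.
Variable K : comNzRingType.
Implicit Types (u : 'cV[K]_(2 * 2)) (A B : 'M[K]_2).

(** The simple tensor [x *t y] becomes [x *m y^T]. *)
Definition tens_mx u : 'M[K]_2 := \matrix_(i, j) u (mxtens_index (i, j)) 0.

Lemma tens_mx_mul A B u : tens_mx ((A *t B) *m u) = A *m tens_mx u *m B^T.
Proof.
apply/matrixP => i j; rewrite !mxE.
pose F k l := A i k * B j l * u (mxtens_index (k, l)) 0.
transitivity (\sum_k \sum_l F k l).
  rewrite pair_big /= (reindex (@mxtens_index 2 2)) /=; last first.
    exists (@mxtens_unindex 2 2) => x _; first exact: mxtens_indexK.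
    exact: mxtens_unindexK.
  by apply: eq_bigr => -[k l] _; rewrite tensmxE.
rewrite exchange_big; apply: eq_bigr => l _; rewrite !mxE big_distrl.
by apply: eq_bigr => k _; rewrite !mxE /F mulrAC.
Qed.

Lemma tens_mx_inj : injective tens_mx.
Proof.
move=> u v /matrixP uv; apply/matrixP => k j; rewrite [j]ord1.
by case: (mxtens_indexP k) => i l; have := uv i l; rewrite !mxE.
Qed.

Lemma tens_mx_sum (I : finType) (F : I -> 'cV[K]_(2 * 2)) :
  tens_mx (\sum_i F i) = \sum_i tens_mx (F i).
Proof.
by apply/matrixP => i j; rewrite mxE !summxE; apply: eq_bigr => k _; rewrite mxE.
Qed.

Lemma tens_mx0 : tens_mx 0 = 0.
Proof. by apply/matrixP => i j; rewrite !mxE. Qed.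

Lemma tens_mx_scale k u : tens_mx (k *: u) = k *: tens_mx u.
Proof. by apply/matrixP => i j; rewrite !mxE. Qed.

Lemma tens_mx_sum_tens1 (I : finType) (F : I -> 'M[K]_2)
    (u : I -> 'cV[K]_(2 * 2)) :
  \sum_i (F i *t 1%:M) *m u i = 0 <-> \sum_i F i *m tens_mx (u i) = 0.
Proof.
have -> : \sum_i F i *m tens_mx (u i) = tens_mx (\sum_i (F i *t 1%:M) *m u i).
  rewrite tens_mx_sum; apply: eq_bigr => i _.
  by rewrite tens_mx_mul trmx1 mulmx1.
by split=> [-> | /esym]; [rewrite tens_mx0 | rewrite -tens_mx0 => /tens_mx_inj].
Qed.

(** Acting on the second factor is right multiplication by the transpose; transposing the whole
    equation moves it to the left. The second equation is thus the first one for the transposed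
    matrix. *)
Lemma tens_mx_sum_tens2 (I : finType) (F : I -> 'M[K]_2)
    (u : I -> 'cV[K]_(2 * 2)) :
  \sum_i (1%:M *t F i) *m u i = 0 <-> \sum_i F i *m (tens_mx (u i))^T = 0.
Proof.
have -> : \sum_i F i *m (tens_mx (u i))^T =
    (tens_mx (\sum_i (1%:M *t F i) *m u i))^T.
  rewrite tens_mx_sum linear_sum; apply: eq_bigr => i _ /=.
  by rewrite tens_mx_mul mul1mx trmx_mul trmxK.
split=> [-> | /(congr1 trmx)]; first by rewrite tens_mx0 trmx0.
by rewrite trmxK trmx0 -tens_mx0 => /tens_mx_inj.
Qed.

End Vec.

Section VecDiff.
Variables (K : numFieldType) (V : normedModType K).

Lemma is_diff_tens_mx (f df : V -> 'cV[K]_(2 * 2)) x :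
  is_diff x f df <->
  is_diff x (fun z => tens_mx (f z)) (fun v => tens_mx (df v)).
Proof.
have tens_mxE (F : V -> 'cV[K]_(2 * 2)) i j :
    (fun z => tens_mx (F z) i j) = (fun z => F z (mxtens_index (i, j)) 0).
  by apply/funext => z; rewrite mxE.
split=> fx; apply: is_diff_mx => i j.
  by rewrite !tens_mxE; exact: is_diff_coord.
rewrite [j]ord1; case: (mxtens_indexP i) => k l; rewrite -!tens_mxE.
exact: is_diff_coord.
Qed.

End VecDiff.

(** * The left action *)

Section Left.
Variable R : realType.

Lemma symSP (u : SS R) : symS u <-> (tens_mx u)^T = tens_mx u.
Proof.
split=> [us | /matrixP us] => [|i j].
  by apply/matrixP => i j; rewrite !mxE us.
by have := us j i; rewrite !mxE.
Qed.

Lemma differentiable_tens_mx (f : HC R -> SS R) Z :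
  differentiable f Z -> differentiable (fun X => tens_mx (f X)) Z /\
  forall v, tens_mx ('D_v f Z) = 'D_v (fun X => tens_mx (f X)) Z.
Proof.
move=> df; have /is_diff_tens_mx[dG GE] := differentiableP df.
by split=> // v; rewrite (deriveE _ df) (deriveE _ dG) GE.
Qed.

Lemma differentiable_of_tens_mx (f : HC R -> SS R) Z :
  differentiable (fun X => tens_mx (f X)) Z -> differentiable f Z.
Proof.
move=> /differentiableP dG.
(* [unmat] inverts [tens_mx]; it turns the differential of the matrix function into a candidate
   differential for [f]. *)
pose unmat (M : HC R) : SS R :=
  \col_k M (mxtens_unindex k).1 (mxtens_unindex k).2.
have uK M : tens_mx (unmat M) = M.
  by apply/matrixP => i j; rewrite !mxE mxtens_indexK.
have [//] : is_diff Z f (fun v => unmat ('d (fun X => tens_mx (f X)) Z v)).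
by apply/is_diff_tens_mx; apply: is_diff_eq dG _; apply/funext => v; rewrite uK.
Qed.

(** The two equations become the same condition on [G] and on its transpose. Symmetry of [G] is
    known on [U] only, with no openness at this stage, so the two differentials are kept apart. *)
Lemma doubly_left_regularP U (f : HC R -> SS R) : doubly_left_regular U f <->
  forall Z, U Z -> let G X := tens_mx (f X) in
    [/\ (G Z)^T = G Z, differentiable G Z,
        delta_regular ('d G Z) & delta_regular ('d (fun X => (G X)^T) Z)].
Proof.
have regP Z : differentiable f Z -> let G X := tens_mx (f X) in
    (\sum_j (e R j *t 1%:M) *m 'D_(e R j) f Z = 0 <-> delta_regular ('d G Z)) /\
    (\sum_j (1%:M *t e R j) *m 'D_(e R j) f Z = 0 <->
     delta_regular ('d (fun X => (G X)^T) Z)).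
  move=> df G; have [dG GE] := differentiable_tens_mx df.
  have [dGT GTE] := is_diff_trmx (differentiableP dG).
  split.
    rewrite -(regular_atP dG) tens_mx_sum_tens1 /regular_at.
    by under eq_bigr do rewrite GE.
  rewrite -(regular_atP dGT) tens_mx_sum_tens2 /regular_at.
  have GTD v : 'D_v (fun X => (G X)^T) Z = ('D_v G Z)^T.
    have DGT := deriveE v dGT; rewrite (deriveE v dG) DGT.
    exact: (congr1 (fun F : HC R -> HC R => F v) GTE).
  by under eq_bigr do rewrite GE -GTD.
split=> [[fs fd f1 f2] Z UZ G | fU].
  have [dG _] := differentiable_tens_mx (fd Z UZ).
  have [r1 r2] := regP _ (fd Z UZ).
  by split=> //; [exact/symSP/fs | exact/r1/f1 | exact/r2/f2].
have fd Z : U Z -> differentiable f Z.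
  by move=> /fU[_ ? _ _]; exact: differentiable_of_tens_mx.
split=> // Z UZ; have [Gs _ r1 r2] := fU Z UZ.
- exact/symSP.
- by have [[_ r1'] _] := regP _ (fd Z UZ); exact: (r1' r1).
- by have [_ [_ r2']] := regP _ (fd Z UZ); exact: (r2' r2).
Qed.

Lemma doubly_left_regular_mob (a b c d : HC R) U (f : HC R -> SS R) :
  open U -> doubly_left_regular U f ->
  let D := [set Z | N (den c d Z) != 0 /\ U (mob a b c d Z)] in
  open D /\ doubly_left_regular D (fun Z =>
    ((N (den c d Z))^-1 *: (invmx (den c d Z) *t invmx (den c d Z)))
      *m f (mob a b c d Z)).
Proof.
move=> oU /doubly_left_regularP fU D.
have DE : D = [set Z | den c d Z \in unitmx /\ U (mob a b c d Z)].
  by apply/funext => Z; rewrite /D /= unitmxE unitfE.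
rewrite DE; split; first exact: open_mob.
apply/doubly_left_regularP => Z [uZ UZ] G.
have -> : G = slash a b c d (fun W => tens_mx (f W)).
  apply/funext => X; rewrite /G -scalemxAl tens_mx_scale tens_mx_mul.
  by rewrite /slash det_inv.
have [Gs dG r1 r2] := fU _ UZ.
split.
- by rewrite /slash linearZ /= !trmx_mul trmxK Gs mulmxA.
- by case: (is_diff_slash uZ dG).
- exact: (delta_regular_slash uZ dG Gs r1).
(* For the second factor: [p G p^T] has transpose [p G^T p^T], so transposition commutes with
   [slash] and the first-factor argument applies to the transposed function. *)
have [dGT _] := is_diff_trmx (differentiableP dG).
have -> : (fun X => (slash a b c d (fun W => tens_mx (f W)) X)^T) =
    slash a b c d (fun W => (tens_mx (f W))^T).
  by apply/funext => X; rewrite /slash linearZ /= !trmx_mul trmxK mulmxA.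
apply: (delta_regular_slash uZ dGT _ r2).
by rewrite trmxK Gs.
Qed.

End Left.

(** * The right action, by transposition *)

Lemma tensNmx (K : pzRingType) m n p q (A : 'M[K]_(m, n)) (B : 'M[K]_(p, q)) :
  (- A) *t B = - (A *t B).
Proof. by apply/matrixP => i j; rewrite !mxE mulNr. Qed.

Lemma tensmxN (K : pzRingType) m n p q (A : 'M[K]_(m, n)) (B : 'M[K]_(p, q)) :
  A *t (- B) = - (A *t B).
Proof. by apply/matrixP => i j; rewrite !mxE mulrN. Qed.

Lemma is_diff_conj_trmx (K : numFieldType) k l m n
    (F : 'M[K]_(k, l) -> 'M[K]_(m, n)) (Z : 'M[K]_(l, k)) :
  differentiable F (Z^T) ->
  is_diff Z (fun X => (F X^T)^T) (fun X => ('d F (Z^T) X^T)^T).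
Proof.
move=> dF; apply: is_diff_trmx.
have DT : is_diff Z trmx trmx := is_diff_trmx (is_diff_id Z).
exact: (is_diff_comp DT (differentiableP dF)).
Qed.

Lemma open_trmx (K : numFieldType) m n (U : set 'M[K]_(m, n)) :
  open U -> open [set Z : 'M[K]_(n, m) | U Z^T].
Proof.
move=> oU; apply: open_comp oU => Z _.
by have [/differentiable_continuous] := is_diff_trmx (is_diff_id Z).
Qed.

Section Right.
Variable R : realType.

Lemma e_trmx (j : 'I_4) : (e R j)^T = e R j \/ (e R j)^T = - e R j.
Proof.
have mx2T (a b c d : CC R) : (mx2 a b c d)^T = mx2 a c b d.
  by apply: matrix2P; rewrite !mxE.
case: j => [[|[|[|[|//]]]]] j4; rewrite /e (tnth_nth 0) /= mx2T.
- by left.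
- by left.
- by right; apply: matrix2P; rewrite !mxE /= ?oppr0 ?opprK.
- by left.
Qed.

(** Transposition changes each [e j] at most by a sign. It does so once in the coefficient [T (e j)]
    on the left and once in the direction of differentiation on the right, so the signs agree. [T]
    stands for tensoring with 1 on either side. *)
Lemma trmx_right_sum (g : HC R -> SS' R) Z (T : HC R -> 'M[CC R]_(2 * 2)) :
  differentiable g (Z^T) ->
  (forall A, T (- A) = - T A) -> (forall A, (T A)^T = T A^T) ->
  (\sum_j 'D_(e R j) g (Z^T) *m T (e R j))^T =
  \sum_j T (e R j) *m 'D_(e R j) (fun X => (g X^T)^T) Z.
Proof.
move=> dg TN TT; rewrite linear_sum; apply: eq_bigr => j _ /=.
have [df dfE] := is_diff_conj_trmx dg.
rewrite (deriveE _ dg) (deriveE _ df).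
have -> : 'd (fun X => (g X^T)^T) Z (e R j) = ('d g (Z^T) (e R j)^T)^T.
  exact: (congr1 (fun F : HC R -> SS R => F (e R j)) dfE).
rewrite trmx_mul TT; case: (e_trmx j) => -> //.
rewrite TN linearN.
by rewrite [(- _)^T]linearN mulNmx mulmxN.
Qed.

Lemma symS'P (v : SS' R) : symS' v <-> symS v^T.
Proof. by split=> vs i j; have := vs i j; rewrite !mxE. Qed.

(** Transposing the values turns rows into columns and right multiplications into left ones;
    transposing the argument as well keeps the family [e j] stable up to sign. *)
Lemma doubly_right_regularP U (g : HC R -> SS' R) :
  doubly_right_regular U g <->
  doubly_left_regular [set Z | U Z^T] (fun X => (g X^T)^T).
Proof.
have s1 Z : differentiable g (Z^T) ->
    (\sum_j 'D_(e R j) g (Z^T) *m (e R j *t 1%:M))^T =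
    \sum_j (e R j *t 1%:M) *m 'D_(e R j) (fun X => (g X^T)^T) Z.
  move=> dg; apply: (trmx_right_sum (T := fun A => A *t 1%:M)) => // A.
    exact: tensNmx.
  by rewrite trmx_tens trmx1.
have s2 Z : differentiable g (Z^T) ->
    (\sum_j 'D_(e R j) g (Z^T) *m (1%:M *t e R j))^T =
    \sum_j (1%:M *t e R j) *m 'D_(e R j) (fun X => (g X^T)^T) Z.
  move=> dg; apply: (trmx_right_sum (T := fun A => 1%:M *t A)) => // A.
    exact: tensmxN.
  by rewrite trmx_tens trmx1.
split=> [[gs gd g1 g2] | [fs fd f1 f2]].
  split=> Z UZ.
  - exact/symS'P/gs.
  - by case: (is_diff_conj_trmx (gd _ UZ)).
  - by rewrite -(s1 _ (gd _ UZ)) (g1 _ UZ) trmx0.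
  - by rewrite -(s2 _ (gd _ UZ)) (g2 _ UZ) trmx0.
have UT Z : U Z -> U Z^T^T by rewrite trmxK.
have gd Z : U Z -> differentiable g Z.
  move=> UZ; have [+ _] := is_diff_conj_trmx (fd Z^T (UT Z UZ)).
  by have -> : (fun X => (g X^T^T)^T^T) = g by apply/funext => X; rewrite !trmxK.
have gdT Z : U Z -> differentiable g (Z^T)^T by rewrite trmxK; exact: gd.
split=> // Z UZ.
- by apply/symS'P; have := fs Z^T (UT _ UZ); rewrite trmxK.
- apply: trmx_inj; have := s1 _ (gdT _ UZ).
  by rewrite (f1 _ (UT _ UZ)) trmxK trmx0.
- apply: trmx_inj; have := s2 _ (gdT _ UZ).
  by rewrite (f2 _ (UT _ UZ)) trmxK trmx0.
Qed.

End Right.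

Theorem theorem3 (R : realType) :
  (forall (h : 'M[CC R]_(2 + 2)) (U : set (HC R)) (f : HC R -> SS R),
      h \in unitmx -> open U -> doubly_left_regular U f ->
      open (dom_dl h U) /\ doubly_left_regular (dom_dl h U) (pi_dl h f))
  /\
  (forall (h : 'M[CC R]_(2 + 2)) (U : set (HC R)) (g : HC R -> SS' R),
      h \in unitmx -> open U -> doubly_right_regular U g ->
      open (dom_dr h U) /\ doubly_right_regular (dom_dr h U) (pi_dr h g)).
Proof.
(* [dom_dl h U] and [pi_dl h f] unfold to the general statement at the blocks of [invmx h]. *)
split=> h U g _ oU; first exact: doubly_left_regular_mob.
move=> /doubly_right_regularP gU.
(* These blocks come from transposing: [a' - Z c'] becomes [- c'^T Z^T + a'^T], and [- b' + Z d']
   becomes [d'^T Z^T - b'^T]. *)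
pose a := (drsubmx h)^T; pose b := - (ursubmx h)^T.
pose c := - (dlsubmx h)^T; pose d := (ulsubmx h)^T.
have denE Z : den_r h Z = (den c d Z^T)^T.
  rewrite /den_r /den /c /d linearD /= mulNmx linearN /= trmx_mul !trmxK.
  by rewrite addrC.
have mobE Z : mob_r h Z = (mob a b c d Z^T)^T.
  rewrite /mob_r /mob denE trmx_mul trmx_inv /a /b.
  by rewrite [(_ - _)^T]linearB /= trmx_mul !trmxK addrC.
have [oD DR] := doubly_left_regular_mob a b c d (open_trmx oU) gU.
have NE Z : N (den_r h Z) = N (den c d Z^T) by rewrite denE /N det_tr.
have domE : [set Z | dom_dr h U Z^T] =
    [set Z | N (den c d Z) != 0 /\ U (mob a b c d Z)^T].
  by apply/funext => Z; rewrite /dom_dr /= NE mobE !trmxK.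
split.
  have -> : dom_dr h U = [set Z | [set W | dom_dr h U W^T] Z^T].
    by apply/funext => Z; rewrite /= trmxK.
  by apply: open_trmx; rewrite domE.
apply/doubly_right_regularP; rewrite domE.
have -> // : (fun X => (pi_dr h g X^T)^T) = (fun Z =>
    ((N (den c d Z))^-1 *: (invmx (den c d Z) *t invmx (den c d Z)))
      *m (g (mob a b c d Z)^T)^T).
apply/funext => Z; rewrite /pi_dr trmx_mul NE mobE denE !trmxK.
by rewrite linearZ /= trmx_tens !trmx_inv !trmxK.
Qed.
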